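(* For every fixed integer $\ell \ge 3$, \[ r(s;\ell) = \Omega\left(2^{(\ell-1)s/2}\right) \] as $s \to \infty$.
   Context: For positive integers $s$ and $\ell$, the multicolor Ramsey number $r(s;\ell)$ is the minimum integer $n$ such that every coloring of the edges of the complete graph $K_n$ with $\ell$ colors contains a monochromatic clique of size $s$. *)

(* Defs.v *)
From mathcomp Require Import all_boot.
From Stdlib Require Import Reals ClassicalEpsilon.

Set Implicit Arguments.
Unset Strict Implicit.
Unset Printing Implicit Defensive.

(* An l-coloring of the edges of K_n: a colour in 'I_l for every edge,
   where the edge {x,y} (x != y) is represented as the 2-set [set x; y].
   A monochromatic clique of size s: a vertex set S with #|S| = s
   all of whose edges get the same colour k. *)
Definition has_mono_clique (n s l : nat) (c : {set 'I_n} -> 'I_l) : bool :=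
  [exists S : {set 'I_n}, (#|S| == s) &&
     [exists k : 'I_l, [forall x in S, forall y in S, (x != y) ==> (c [set x; y] == k)]]].

Definition ramsey_prop (s l n : nat) : bool :=
  [forall c : {ffun {set 'I_n} -> 'I_l}, has_mono_clique s c].

(* r(s;l): the minimum n with ramsey_prop s l n (exists by Ramsey's theorem;
   the fallback value 0 is never used when such an n exists). *)
Definition ramsey_num (s l : nat) : nat :=
  match excluded_middle_informative (exists n, ramsey_prop s l n) with
  | left H => ex_minn H
  | right _ => 0
  end.

(* Main.v *)
Require Import Defs.
From Stdlib Require Import Reals Lra ClassicalEpsilon.
From mathcomp Require Import all_boot all_algebra zify.

(* Give every vertex v of K_N, for each of the l - 1 first colours, an independent
   uniformly random pair (f_v, g_v) of vectors of F_2^n, with n = s - 2, and give an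
   edge u < v the first colour for which <f_u, g_v - g_u> = 1, or the last colour if
   there is none.  Along a clique u_1 < u_2 < ... in one of the first l - 1 colours,
   the affine subspaces {h | <f_{u_i}, h - g_{u_i}> = 1 for i < j} containing g_{u_j}
   have strictly decreasing dimension, so that the clique has at most n + 1 vertices.
   On the other hand s given vertices satisfy <f_u, g_v - g_u> = 0 for all u < v with
   probability only 2^(-s^2/2 + O(s)): a new f either lies in the span of the previous
   ones, which is unlikely, or halves the set allowed to the later g.  Hence they form
   a clique in the last colour with probability 2^(-(l-1)s^2/2 + O(ls)), and the union
   bound over the N^s sets of size s succeeds for N up to a constant times
   2^((l-1)s/2). *)

Import GRing.Theory.

Set Implicit Arguments.
Unset Strict Implicit.
Unset Printing Implicit Defensive.

Section Counting.
Local Open Scope ring_scope.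
Local Notation V n := 'rV['F_2]_n.

(** * The bilinear form on F_2^n and its annihilators *)

Definition dot n (f g : V n) : 'F_2 := (f *m g^T) 0 0.

Lemma dotC n (f g : V n) : dot f g = dot g f.
Proof. by rewrite /dot !mxE; apply: eq_bigr => i _; rewrite !mxE mulrC. Qed.

Lemma dotB n (f g h : V n) : dot f (g - h) = dot f g - dot f h.
Proof. by rewrite /dot linearB /= mulmxBr !mxE. Qed.

Lemma dot0 n (f : V n) : dot f 0 = 0.
Proof. by rewrite -(subrr 0) dotB subrr. Qed.

Lemma exists_dot_neq0 n (g : V n) : g != 0 -> exists f, dot f g != 0.
Proof.
case/rV0Pn => i gi; exists (delta_mx 0 i).
by rewrite /dot -rowE !mxE.
Qed.

Lemma F2_sub_neq0 (a b : 'F_2) : a != 0 -> b != 0 -> a - b = 0.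
Proof. by case: a b => [[|[|a]] ha] [[|[|b]] hb] //= _ _; apply: val_inj. Qed.

(** Over F_2 these are exactly the linear subspaces. Sets are used because only cardinalities
    matter: dimension [d] is expressed as [#|K| = 2 ^ d]. *)
Definition is_subgroup n (K : {set V n}) :=
  0 \in K /\ {in K &, forall x y, x - y \in K}.

Definition perp n (K : {set V n}) (f : V n) := K :&: [set g | dot f g == 0].

Lemma perp_subgroup n (K : {set V n}) f : is_subgroup K -> is_subgroup (perp K f).
Proof.
case=> K0 KB; split; first by rewrite !inE K0 dot0 /=.
move=> x y; rewrite !inE => /andP[xK /eqP fx] /andP[yK /eqP fy].
by rewrite KB //= dotB fx fy subrr.
Qed.

Lemma perp_neq n (K : {set V n}) f :
  perp K f != K -> exists2 x, x \in K & dot f x != 0.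
Proof.
move=> nK; apply/exists_inP; apply: contraR nK => /exists_inPn H.
apply/eqP/setIidPl/subsetP => x xK; rewrite inE.
by apply: contraT => /(negP (H x xK)).
Qed.

(** The involution x -> [k0] - x of [K] exchanges the vectors with product 0 and those with product
    1. *)
Lemma card_perp n (K : {set V n}) f k0 : is_subgroup K -> k0 \in K -> dot f k0 != 0 ->
  ((#|perp K f|).*2 = #|K|)%N.
Proof.
case=> K0 KB k0K fk0.
rewrite -(cardsID [set g | dot f g == 0] K) -/(perp K f) -addnn; congr addn.
have kB : involutive (fun x => k0 - x) by move=> x; rewrite opprB addrC subrK.
rewrite -(card_imset _ (inv_inj kB)); apply: eq_card => y.
apply/imsetP/idP => [[x]|].
- rewrite !inE => /andP[xK /eqP fx] ->.
  by rewrite KB // dotB fx subr0 fk0.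
- rewrite !inE => /andP[fy yK]; exists (k0 - y); last by rewrite kB.
  by rewrite !inE KB //= dotB F2_sub_neq0.
Qed.

Lemma card_V n : #|{: V n}| = (2 ^ n)%N.
Proof. by rewrite card_mx card_Fp // mul1n. Qed.

Lemma setT_subgroup n : is_subgroup [set: V n].
Proof. by split=> [|x y]; rewrite !inE. Qed.

(* Count the pairs [(f, k)] with [k] in [K] and [dot f k = 0] in both orders. *)
Lemma card_annihilator n (K : {set V n}) : is_subgroup K ->
  (#|[set f | perp K f == K]| * #|K| = 2 ^ n)%N.
Proof.
move=> sK; have [K0 _] := sK.
(* Doubling avoids division: twice [#|perp K f|] is [2 * #|K|] or [#|K|] according to whether [f]
   annihilates [K]. *)
have half f : ((#|perp K f|).*2 = (f \in [set f | perp K f == K]) * #|K| + #|K|)%N.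
  rewrite inE; case: eqP => [->|nK]; first by rewrite mul1n addnn.
  have [k kK fk] := perp_neq (introN eqP nK).
  by rewrite mul0n (card_perp sK kK fk).
have halfk (k : V n) : (#|[set f | dot f k == 0%R]|.*2 = (k == 0%R) * 2 ^ n + 2 ^ n)%N.
  case: eqP => [->|/eqP /exists_dot_neq0 [f fk]].
    by rewrite mul1n addnn -card_V -cardsT; congr double; apply: eq_card => f; rewrite !inE dot0 eqxx.
  rewrite dotC in fk.
  have := card_perp (@setT_subgroup n) (in_setT f) fk.
  rewrite cardsT card_V mul0n add0n => <-; congr double.
  by apply: eq_card => g; rewrite !inE dotC.
have E : (\sum_(f : V n) #|perp K f| = \sum_(k in K) #|[set f | dot f k == 0%R]|)%N.
  transitivity (\sum_(f : V n) \sum_(k in perp K f) 1)%N.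
    by apply: eq_bigr => f _; rewrite sum1_card.
  rewrite (exchange_big_dep (mem K)) /=; last by move=> f k _; rewrite inE => /andP[].
  by apply: eq_bigr => k kK; rewrite -sum1_card; apply: eq_bigl => f; rewrite !inE kK.
move/(congr1 double): E; rewrite !(big_morph double doubleD double0).
rewrite (eq_bigr _ (fun f _ => half f)) (eq_bigr _ (fun k _ => halfk k)).
rewrite !big_split /= !sum_nat_const card_V -!big_distrl /=.
have -> : (\sum_(k in K) (k == 0%R) = 1)%N.
  by rewrite (bigD1 0) //= eqxx big1 // => k /andP[_ /negbTE->].
(* The term [2 ^ n * #|K|] occurs on both sides of the double count and cancels. *)
rewrite mul1n [(#|K| * _)%N]mulnC => /addIn <-; congr muln.
by rewrite -sum1_card big_mkcond /=; apply: eq_bigr => f _; case: (_ \in _).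
Qed.

(** * Sequences of pairs confined to a coset *)

(** Not symmetric: [p] stands for the earlier vertex, whose vector f is tested against the
    difference of the vectors g. *)
Definition orth n (p q : V n * V n) := dot p.1 (q.2 - p.2) == 0.

Definition in_coset n (K : {set V n}) (g0 : V n) (p : V n * V n) := p.2 - g0 \in K.

Lemma in_coset_shift n (K : {set V n}) g0 p q : is_subgroup K ->
  in_coset K g0 p -> in_coset K g0 q = (q.2 - p.2 \in K).
Proof.
case=> K0 KB; rewrite /in_coset => pK.
have -> : q.2 - p.2 = (q.2 - g0) - (p.2 - g0) by rewrite opprB addrA subrK.
apply/idP/idP => [qK|H]; first exact: KB.
have : ((q.2 - g0) - (p.2 - g0)) - (0 - (p.2 - g0)) \in K by rewrite KB // KB.
by rewrite sub0r opprK subrK.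
Qed.

(** With head [p] and next element [q], every later [r] has [r.2 - p.2] and [q.2 - p.2] both of
    product 1 with [p.1], so [r.2 - q.2] has product 0. The tail thus lies in a coset of
    [perp K p.1], half as large as [K], and [d] drops by one. *)
Lemma size_pairwise_nonorth n (K : {set V n}) d g0 t : is_subgroup K ->
  #|K| = (2 ^ d)%N -> all (in_coset K g0) t -> pairwise (fun p q => ~~ orth p q) t ->
  (size t <= d.+1)%N.
Proof.
elim: t K d g0 => [//|p [//|q t] IH] K d g0 sK cK.
move=> /andP[pK tK] /= /andP[/andP[pq pt] qt].
have E := in_coset_shift _ sK pK.
have qpK : q.2 - p.2 \in K by move: tK => /andP[]; rewrite E.
have half := card_perp sK qpK pq.
case: d cK => [|d] cK; first by move: half; rewrite cK; lia.
apply: (IH (perp K p.1) d q.2) => //; first exact: perp_subgroup.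
  by move: half; rewrite cK expnS; lia.
have [K0 KB] := sK.
apply/allP => r rt; rewrite /in_coset !inE.
have rpK : r.2 - p.2 \in K by rewrite -E; exact: (allP (tK : all (in_coset K g0) (q :: t))) rt.
have -> : r.2 - q.2 = (r.2 - p.2) - (q.2 - p.2) by rewrite opprB addrA subrK.
rewrite KB //= dotB F2_sub_neq0 //.
by move: rt; rewrite inE => /predU1P[-> //|]; exact: (allP pt).
Qed.

Lemma card_cons_tuple (T : finType) k (P : pred (seq T)) :
  #|[set t : k.+1.-tuple T | P t]| = (\sum_(x : T) #|[set t : k.-tuple T | P (x :: t)]|)%N.
Proof.
rewrite -sum1_card (partition_big (@thead k T) xpredT) //=.
apply: eq_bigr => x _; rewrite -sum1_card.
rewrite (reindex (fun t : k.-tuple T => [tuple of x :: t])) /=.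
  by apply: eq_bigl => t; rewrite !inE theadE eqxx andbT.
exists (fun t : k.+1.-tuple T => [tuple of behead t]) => t; first by move=> _; apply: val_inj.
by rewrite inE => /andP[_ /eqP <-]; rewrite -tuple_eta.
Qed.

(** Induction on the head (f, g): g has [#|K|] choices, and the tail lies in the coset of [perp K f]
    through g. Either f annihilates [K], which happens for only 2^(n-d) vectors, or the dimension
    drops to d-1. The two cases contribute equally to the bound, whence a factor 2^(n+1) per
    element. *)
Lemma card_pairwise_orth n (K : {set V n}) d g0 k : is_subgroup K ->
  #|K| = (2 ^ d)%N ->
  (#|[set t : k.-tuple (V n * V n) | all (in_coset K g0) t && pairwise (@orth n) t]|
    <= 2 ^ (n.+1 * k) * 2 ^ 'C(d.+1, 2))%N.
Proof.
elim: k K d g0 => [|k IH] K d g0 sK cK.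
  rewrite (leq_trans (max_card _)) // card_tuple expn0.
  by rewrite -expnD expn_gt0.
rewrite (@card_cons_tuple _ _ (fun t => all (in_coset K g0) t && pairwise (@orth n) t)) /=.
rewrite -(pair_bigA _ (fun f g => #|[set t : k.-tuple (V n * V n) |
   in_coset K g0 (f, g) && all (in_coset K g0) t && (all (orth (f, g)) t && pairwise (@orth n) t)]|)) /=.
have step f : (\sum_(g : V n) #|[set t : k.-tuple (V n * V n) |
   in_coset K g0 (f, g) && all (in_coset K g0) t && (all (orth (f, g)) t && pairwise (@orth n) t)]|
   <= #|K| * (2 ^ (n.+1 * k) * (if perp K f == K then 2 ^ 'C(d.+1, 2) else 2 ^ 'C(d, 2))))%N.
  have -> : #|K| = #|[set g | in_coset K g0 (f, g)]|.
    rewrite -[LHS](card_imset _ (addIr g0)); apply: eq_card => g.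
    apply/imsetP/idP => [[x xK ->]|]; rewrite inE /in_coset /= ?addrK // => gK.
    by exists (g - g0); rewrite ?subrK.
  rewrite -sum_nat_const [leqRHS]big_mkcond /=; apply: leq_sum => g _.
  rewrite inE; case: ifP => gK; last by rewrite leqn0 cards_eq0; apply/eqP/setP => t; rewrite !inE.
  have -> : [set t : k.-tuple (V n * V n) | true && all (in_coset K g0) t &&
      (all (orth (f, g)) t && pairwise (@orth n) t)]
    = [set t : k.-tuple (V n * V n) | all (in_coset (perp K f) g) t && pairwise (@orth n) t].
    apply/setP => t; rewrite !inE /= andbA -all_predI; congr andb.
    apply: eq_all => q /=; rewrite (in_coset_shift _ sK gK) /in_coset !inE.
    by rewrite /orth.
  case: eqP => [-> | nK]; first exact: IH.
  have [x xK fx] := perp_neq (introN eqP nK).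
  have half := card_perp sK xK fx.
  case: d cK => [|d] cK; first by move: half; rewrite cK; lia.
  by apply: IH; [exact: perp_subgroup | move: half; rewrite cK expnS; lia].
apply: leq_trans (leq_sum _ (fun f _ => step f)) _.
rewrite -big_distrr -big_distrr /=.
have Csum : (\sum_(f : V n) (if perp K f == K then 2 ^ 'C(d.+1, 2) else 2 ^ 'C(d, 2))
    <= #|[set f | perp K f == K]| * 2 ^ 'C(d.+1, 2) + 2 ^ n * 2 ^ 'C(d, 2))%N.
  have -> : (2 ^ n * 2 ^ 'C(d, 2) = \sum_(f : V n) 2 ^ 'C(d, 2))%N by rewrite sum_nat_const card_V.
  rewrite -sum_nat_const [X in (_ <= X + _)%N]big_mkcond -big_split /=.
  by apply: leq_sum => f _; rewrite inE; case: ifP => _; rewrite ?leq_addr ?leq_addl.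
(* This identity makes the two cases balance: 2^(n-d) * 2^d = 2^n. *)
have CS : (2 ^ 'C(d.+1, 2) = 2 ^ d * 2 ^ 'C(d, 2))%N by rewrite binS bin1 -expnD addnC.
have := card_annihilator sK; rewrite cK => CA.
apply: (@leq_trans (2 ^ d * (2 ^ (n.+1 * k) * (#|[set f | perp K f == K]| * 2 ^ 'C(d.+1, 2)
  + 2 ^ n * 2 ^ 'C(d, 2))))%N); first by rewrite !leq_mul.
have -> : (2 ^ (n.+1 * k.+1) = 2 ^ (n.+1 * k) * (2 * 2 ^ n))%N by rewrite -expnS -expnD mulnS addnC.
rewrite -CA CS; lia.
Qed.

(** * Random labellings and the union bound *)

(** A uniform labelling restricted to [s] distinct indices is uniform; the denominators are
    cleared. *)
Lemma card_map_uniq_tuple (I X : finType) s (t : s.-tuple I) (A : {set s.-tuple X}) :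
  uniq t ->
  (#|[set y : {ffun I -> X} | [tuple of map y t] \in A]| * #|X| ^ s <= #|A| * #|X| ^ #|I|)%N.
Proof.
move=> ut.
pose B := [set y : {ffun I -> X} | [tuple of map y t] \in A].
pose over (y : {ffun I -> X}) (z : s.-tuple X) : {ffun I -> X} :=
  [ffun i => nth (y i) z (index i t)].
have over_in y z j : over y z (tnth t j) = tnth z j.
  by rewrite ffunE [in index _ _](tnth_nth (tnth t j)) index_uniq ?size_tuple // -tnth_nth.
have over_out y z i : i \notin t -> over y z i = y i.
  by move=> it; rewrite ffunE nth_default // size_tuple -[X in (X <= _)%N](size_tuple t) leqNgt index_mem.
(* Exchanging the labels of [y] on [t] with the tuple [z] loses no information. *)
pose h (p : {ffun I -> X} * s.-tuple X) := ([tuple of map p.1 t], over p.1 p.2).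
have hinj : injective h.
  move=> [y z] [y' z'] [/= e1 e2].
  have zz : z = z'.
    by apply: eq_from_tnth => j; rewrite -(over_in y) e2 over_in.
  congr pair => //; apply/ffunP => i.
  have [/tnthP[j ->]|it] := boolP (i \in t).
    have := congr1 (fun b : seq X => nth (y (tnth t j)) b j) e1.
    by rewrite !(nth_map (tnth t j)) ?size_tuple // -!tnth_nth.
  by rewrite -(over_out y z) // e2 over_out.
have : (#|h @: setX B [set: s.-tuple X]| <= #|setX A [set: {ffun I -> X}]|)%N.
  apply/subset_leq_card/subsetP => _ /imsetP[[y z] yz ->].
  by move: yz; rewrite !inE /= !andbT.
by rewrite card_imset // !cardsX !cardsT card_tuple card_ffun.
Qed.

Lemma exists_not_all_orth m n s N :
  (N ^ s * (2 ^ (n.+1 * s) * 2 ^ 'C(n.+1, 2)) ^ m < 2 ^ (2 * n * s * m))%N ->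
  exists phi : {ffun 'I_m -> {ffun 'I_N -> V n * V n}},
  forall S : {set 'I_N}, #|S| = s ->
    exists i, ~~ pairwise (@orth n) (map (phi i) (enum S)).
Proof.
move=> lt.
pose Omega : finType := {ffun 'I_m -> {ffun 'I_N -> V n * V n}}.
pose bad (S : {set 'I_N}) := [set phi : Omega | [forall i, pairwise (@orth n) (map (phi i) (enum S))]].
suff /existsP[phi /forall_inP H] :
    [exists phi : Omega, forall (S : {set 'I_N} | #|S| == s), phi \notin bad S].
  by exists phi => S /eqP /H; rewrite inE => /forallPn.
apply: contraLR lt => /existsPn nobad; rewrite -leqNgt.
have cV : #|{: V n * V n}| = (2 ^ (2 * n))%N by rewrite card_prod card_V -expnD addnn mul2n.
have cbad (S : {set 'I_N}) : #|S| = s ->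
    (#|bad S| * 2 ^ (2 * n * s * m) <= (2 ^ (n.+1 * s) * 2 ^ 'C(n.+1, 2)) ^ m * #|Omega|)%N.
  move=> /eqP; rewrite cardE => cS; pose t := Tuple cS.
  pose A := [set u : s.-tuple (V n * V n) | pairwise (@orth n) u].
  have cA : (#|A| <= 2 ^ (n.+1 * s) * 2 ^ 'C(n.+1, 2))%N.
    have := @card_pairwise_orth n setT n 0 s (@setT_subgroup n).
    rewrite cardsT card_V => /(_ erefl); congr (_ <= _)%N; apply: eq_card => u.
    by rewrite !inE (_ : all _ _) //; apply/allP => p _; rewrite /in_coset inE.
  have := card_map_uniq_tuple A (enum_uniq S : uniq t).
  set B := [set y | _] => cB.
  (* Independence of the [m] coordinates: [bad S] is an [m]-fold power of [B]. *)
  have -> : #|bad S| = #|ffun_on_mem 'I_m (mem B)|.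
    apply: eq_card => phi; rewrite inE; apply/forallP/ffun_onP => H i; have := H i; by rewrite !inE.
  rewrite card_ffun_on card_ord card_ffun card_ord card_ffun.
  rewrite 2!expnM -cV -!expnMn; case: (posnP m) => [-> //|m0].
  by rewrite leq_exp2r //; apply: leq_trans cB _; rewrite card_ord leq_mul2r cA orbT.
have : (#|Omega| <= \sum_(S : {set 'I_N} | #|S| == s) #|bad S|)%N.
  under eq_bigr do rewrite -sum1_card.
  rewrite (exchange_big_dep predT) //= -sum1_card; apply: leq_sum => phi _.
  have := nobad phi; rewrite negb_forall_in => /exists_inP[S cS]; rewrite negbK => bS.
  by rewrite (bigD1 S) ?cS.
rewrite -(@leq_pmul2r (2 ^ (2 * n * s * m))) ?expn_gt0 // big_distrl /= => le.
have {le} := leq_trans le (leq_sum _ (fun S cS => cbad S (eqP cS))).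
rewrite sum_nat_const mulnA [X in (X <= _)%N]mulnC leq_pmul2r; last first.
  by rewrite card_ffun card_ffun cV !expn_gt0.
(* It remains to bound the number of [s]-subsets by [N ^ s]. *)
move/leq_trans; apply; rewrite leq_mul2r.
have := card_draws 'I_N s; rewrite card_ord cardsE => ->.
apply/orP; right; apply: (@leq_trans (N ^_ s)); first by rewrite -bin_ffact leq_pmulr ?fact_gt0.
rewrite ffact_prod -[s in (_ <= N ^ s)%N]card_ord -prod_nat_const.
by apply: leq_prod => i _; exact: leq_subr.
Qed.

(** * The colouring and its cliques *)

Lemma pairwise_ltn_enum N (S : {set 'I_N}) : pairwise (relpre val ltn) (enum S).
Proof.
apply: (@subseq_pairwise _ _ _ (enum 'I_N)).
  by rewrite enumT; exact: filter_subseq.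
by rewrite -pairwise_map val_enum_ord -(sorted_pairwise ltn_trans) iota_ltn_sorted.
Qed.

Lemma pigeonhole_sum (J : finType) (F : J -> nat) a :
  (#|J| * a.-1 < \sum_j F j)%N -> exists j, (a <= F j)%N.
Proof.
move=> lt; apply/existsP; apply: contraLR lt => /existsPn small; rewrite -leqNgt.
rewrite -sum_nat_const; apply: leq_sum => j _.
by have := small j; rewrite -ltnNge; case: a {small}.
Qed.

Lemma good_coloring m n s N : (n.+1 < s)%N ->
  (N ^ s * (2 ^ (n.+1 * s) * 2 ^ 'C(n.+1, 2)) ^ m < 2 ^ (2 * n * s * m))%N ->
  ~~ ramsey_prop s m.+1 N.
Proof.
move=> ns /exists_not_all_orth [phi good].
(* Edges are unordered sets, so the order of the endpoints, on which [orth] depends, is recovered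
   from the ordinals. *)
pose split_by (e : {set 'I_N}) i :=
  [exists x in e, exists y in e, (x < y)%N && ~~ orth (phi i x) (phi i y)].
have splitP (x y : 'I_N) i : (x < y)%N ->
    split_by [set x; y] i = ~~ orth (phi i x) (phi i y).
  move=> xy; apply/exists_inP/idP => [[x' + /exists_inP[y']]|H].
    rewrite !inE => /pred2P[]-> /pred2P[]-> /andP[] //; rewrite ?ltnn //.
    by rewrite ltnNge (ltnW xy).
  by exists x; rewrite ?set21 //; apply/exists_inP; exists y; rewrite ?set22 ?xy.
pose c := [ffun e => if [pick i | split_by e i] is Some i then lift ord_max i else ord_max].
rewrite negb_forall; apply/existsP; exists c; apply/negP => /existsP[S /andP[/eqP cS]].
case/existsP => k /forall_inP mono.
have {}mono (x y : 'I_N) : x \in S -> y \in S -> (x < y)%N -> c [set x; y] = k.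
  move=> xS yS xy; apply/eqP; move: (mono x xS) => /forall_inP/(_ y yS)/implyP; apply.
  by rewrite -val_eqE ltn_eqF.
have inS (P : rel 'I_N) : (forall x y, x \in S -> y \in S -> (x < y)%N -> P x y) ->
    pairwise P (enum S).
  move=> HP; apply: (@sub_in_pairwise _ (mem S) (relpre val ltn)) (pairwise_ltn_enum S).
    by move=> x y xS yS; exact: HP.
  by apply/allP => x; rewrite mem_enum.
case: (unliftP ord_max k) => [j|] kE.
  (* In one of the first [m] colours, the clique in increasing order is pairwise non-orthogonal,
     hence too short. *)
  suff : (s <= n.+1)%N by rewrite leqNgt ns.
  rewrite -cS cardE -(size_map (phi j)).
  apply: (size_pairwise_nonorth (@setT_subgroup n) (g0 := 0)).
  - by rewrite cardsT card_V.
  - by apply/allP => p _; rewrite /in_coset inE.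
  - rewrite pairwise_map; apply: inS => x y xS yS xy /=.
    have := mono x y xS yS xy; rewrite ffunE kE; case: pickP => [i|_ /eqP]; last first.
      by rewrite (negbTE (neq_lift _ _)).
    by rewrite splitP // => xyi /lift_inj <-.
(* In the last colour no coordinate splits any edge, against the choice of [phi]. *)
have [i] := good S cS; rewrite pairwise_map => /negP; apply; apply: inS => x y xS yS xy /=.
have := mono x y xS yS xy; rewrite ffunE kE; case: pickP => [j _ /eqP|H _].
  by rewrite eq_sym (negbTE (neq_lift _ _)).
by have := H i; rewrite splitP // => /negbFE.
Qed.

(** * Existence of the Ramsey numbers *)

(** Remove a vertex [x], keep its neighbours in a most popular colour, and label [x] with that
    colour. The base [l.+2], one more than the number of colours, pays for the removed vertex. *)
Lemma exists_end_homogeneous l (I : finType) (c : {set I} -> 'I_l.+1) k (A : {set I}) :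
  (l.+2 ^ k <= #|A|)%N ->
  exists2 t : seq (I * 'I_l.+1), size t = k &
    all (fun p => p.1 \in A) t &&
    pairwise (fun p q => (p.1 != q.1) && (c [set p.1; q.1] == p.2)) t.
Proof.
elim: k A => [|k IH] A cA; first by exists [::].
have /card_gt0P[x xA] : (0 < #|A|)%N by apply: leq_trans cA; rewrite expn_gt0.
pose B j := [set y in A :\ x | c [set x; y] == j].
have [j cB] : exists j, (l.+2 ^ k <= #|B j|)%N.
  apply: pigeonhole_sum; rewrite card_ord.
  have -> : (\sum_j #|B j| = #|A :\ x|)%N.
    rewrite -[RHS]sum1_card (partition_big (fun y => c [set x; y]) xpredT) //=.
    by apply: eq_bigr => j _; rewrite -sum1_card; apply: eq_bigl => y; rewrite inE.
  move: cA; rewrite (cardsD1 x) xA expnS.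
  have : (0 < l.+2 ^ k)%N by rewrite expn_gt0.
  nia.
have [t st /andP[tB tp]] := IH _ cB.
exists ((x, j) :: t); rewrite /= ?st // xA tp andbT; apply/andP; split.
  by apply: sub_all tB => p; rewrite !inE => /andP[/andP[]].
apply: sub_all tB => p; rewrite !inE => /andP[/andP[px _] ->].
by rewrite eq_sym px.
Qed.

(** This rules out the fallback value of [ramsey_num]. Among [l.+1 * s] labelled vertices, [s] share
    a label, and these form the clique. *)
Lemma ramsey_exists s l : exists n, ramsey_prop s l.+1 n.
Proof.
exists (l.+2 ^ (l.+1 * s))%N; apply/forallP => c.
have [|t st /andP[_ tp]] := @exists_end_homogeneous l _ c (l.+1 * s) setT.
  by rewrite cardsT card_ord.
have [k ck] : exists k, (s <= count (fun p => p.2 == k) t)%N.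
  have [s0|s0] := posnP s; first by exists ord0; rewrite [leqLHS]s0.
  apply: pigeonhole_sum; rewrite card_ord.
  have -> : (\sum_(k < l.+1) count (fun p => p.2 == k) t = size t)%N.
    rewrite -[RHS]sum1_size [RHS](partition_big (fun p => p.2) xpredT) //=.
    by apply: eq_bigr => k _; rewrite -sum1_count.
  by rewrite st ltn_pmul2l // prednK.
pose u := take s (filter (fun p => p.2 == k) t).
have uk : all (fun p => p.2 == k) u.
  by apply/allP => p /mem_take; rewrite mem_filter => /andP[].
have up : pairwise (fun p q => (p.1 != q.1) && (c [set p.1; q.1] == k)) u.
  apply: (sub_in_pairwise _ uk (subseq_pairwise (take_subseq _ _) (pairwise_filter _ tp))).
  by move=> p q /eqP pk _ /=; rewrite pk.
have su : size u = s by rewrite size_takel // size_filter.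
have uu : uniq (map fst u).
  rewrite uniq_pairwise pairwise_map; apply: sub_pairwise up => p q.
  by case/andP.
apply/existsP; exists [set x in map fst u]; apply/andP; split.
  by rewrite cardsE (card_uniqP uu) size_map su.
apply/existsP; exists k.
pose r := [rel x y | (x != y) ==> (c [set x; y] == k)].
have : pairwise r (map fst u).
  by rewrite pairwise_map; apply: sub_pairwise up => p q /andP[pq pqk]; rewrite /= pqk implybT.
rewrite pairwise_all2rel => [/allrelP H||]; last first.
- by move=> x y; rewrite /= eq_sym setUC.
- by move=> x; rewrite /= eqxx.
by apply/forall_inP => x xu; apply/forall_inP => y yu; apply: H; move: xu yu; rewrite !inE.
Qed.

Lemma ramsey_num_ramsey_prop s l : (0 < l)%N -> ramsey_prop s l (ramsey_num s l).
Proof.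
case: l => // l _; rewrite /ramsey_num; case: excluded_middle_informative => [H|[]].
  by case: ex_minnP.
exact: ramsey_exists.
Qed.

(** * Numerical bounds and passage to the reals *)

(** A smaller value would satisfy the union bound with n = s - 2, the largest dimension with n + 1 <
    s. Squaring avoids half-integer exponents. *)
Lemma ramsey_num_sqr_ge s m : (4 <= s)%N ->
  (2 ^ (m * (s - 4)) <= ramsey_num s m.+1 ^ 2)%N.
Proof.
move=> s4; have := @ramsey_num_ramsey_prop s m.+1 isT; apply: contraTT; rewrite -ltnNge.
set N := ramsey_num _ _ => lt; apply: (@good_coloring m (s - 2)); first by lia.
have [n sE] : exists n, s = n.+2 by exists (s - 2)%N; lia.
rewrite sE subn2 /= -sE -expnD.
rewrite -(@ltn_exp2r _ _ 2) // expnMn -!expnM [(s * 2)%N]mulnC expnM.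
have bE := mul_bin_diag n.+1 1; rewrite bin1 /= in bE.
have s0 : (0 < s)%N by lia.
move: lt; rewrite -(ltn_exp2r _ _ s0) => lt.
apply: (@leq_trans ((2 ^ (m * (s - 4))) ^ s * 2 ^ ((n.+1 * s + 'C(n.+1, 2)) * m * 2))).
  by rewrite -mulnA ltn_pmul2r ?expn_gt0.
rewrite -expnM -expnD leq_exp2l //.
(* With s = n + 2 the two sides are 4n^2 + 7n and 4n^2 + 8n. *)
have le : ((s - 4) * s + 2 * (n.+1 * s + 'C(n.+1, 2)) <= 4 * n * s)%N.
  move: s4 bE; rewrite sE; case: (n) => [|[|k]] //; lia.
have := leq_mul (leqnn m) le; lia.
Qed.

Lemma exp_le_sqr_ramsey_num s m : (4 <= s)%N ->
  (2 ^ (m * s) <= (4 ^ m * ramsey_num s m.+1) ^ 2)%N.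
Proof.
move=> s4; have := ramsey_num_sqr_ge m s4.
rewrite expnMn -(@leq_pmul2l ((4 ^ m) ^ 2)) ?expn_gt0 // => h; apply: leq_trans h.
by rewrite -(expnM 2 2) -expnM -expnD leq_exp2l //; nia.
Qed.

Lemma INR_expn b k : INR (b ^ k)%N = pow (INR b) k.
Proof. by elim: k => [|k IH] //; rewrite expnS mult_INR IH. Qed.

End Counting.

Unset Implicit Arguments.
Import Reals.

(* r(s;l) = Omega(2^((l-1)s/2)) as s -> oo, for every fixed l >= 3. *)
Theorem theorem1p6 (l : nat) (hl : 3 <= l) :
  exists c : R, (0 < c)%R /\ exists s0 : nat, forall s : nat, s0 <= s ->
    (c * Rpower 2 (INR ((l - 1) * s) / 2) <= INR (ramsey_num s l))%R.
Proof.
case: l hl => [//|m] _; rewrite subn1 /=.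
(* The constant absorbs the shift by 4 in the exponent: (4^m)^2 = 2^(4m). *)
exists (/ 4 ^ m)%R; split; first by apply: Rinv_0_lt_compat; apply: pow_lt; lra.
exists 4 => s s4.
set r := ramsey_num s m.+1.
have p4 : (0 < 4 ^ m)%R by apply: pow_lt; lra.
have key : (2 ^ (m * s) <= (4 ^ m * INR r) ^ 2)%R.
  have /leP/le_INR := exp_le_sqr_ramsey_num m s4.
  by rewrite !INR_expn mult_INR INR_expn (INR_IZR_INZ 2) (INR_IZR_INZ 4).
have sq : (Rpower 2 (INR (m * s) / 2) ^ 2 = 2 ^ (m * s))%R.
  rewrite -(Rpower_pow (m * s) 2); last lra.
  rewrite /= Rmult_1_r -Rpower_plus; congr Rpower; lra.
apply: (Rmult_le_reg_l (4 ^ m)) => //.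
rewrite -Rmult_assoc Rinv_r ?Rmult_1_l; last lra.
apply: (Rsqr_incr_0 _ _); rewrite ?Rsqr_pow2 ?sq //.
- by left; apply: exp_pos.
- by apply: Rmult_le_pos; [lra | exact: pos_INR].
Qed.
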